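(* (Converse duality) Let $(u^*,\tau^*,\lambda^* )\in Y$ and let $u^*$ be a feasible point of the primal problem (VQFP), i.e. $u^*\in S$. If the matrix $F(\tau^*,u^* )=\sum_{i=1}^m\tau_i^*\big[A_i-\frac{f_i(u^* )}{g_i(u^* )}B_i\big]$ is positive semidefinite and $h_j$ is convex for each $j\in J$, then $u^*$ is a Pareto optimal solution of (VQFP).
   Context: Setting. Let $m,\ell,n\ge 1$, $I=\{1,\dots,m\}$, $J=\{1,\dots,\ell\}$, and let $\Omega\subseteq\mathbb{R}^n$ be open. For $i\in I$ and $x\in\mathbb{R}^n$ let $f_i(x)=x^TA_ix+a_i^Tx+\bar a_i$ and $g_i(x)=x^TB_ix+b_i^Tx+\bar b_i$, where $A_i,B_i\in\mathbb{R}^{n\times n}$ are symmetric, $B_i$ is positive semidefinite, $a_i,b_i\in\mathbb{R}^n$, $\bar a_i,\bar b_i\in\mathbb{R}$; the system $2B_ix+b_i=0$ is assumed to have a solution $w^i$, and $\bar b_i>-((w^i)^TB_iw^i+b_i^Tw^i)$, so that $g_i(x)>0$ for all $x\in\mathbb{R}^n$. The functions $h_j:\Omega\to\mathbb{R}$, $j\in J$, are continuously differentiable. The feasible set is $S=\{x\in\Omega: h_j(x)\le 0\ \forall j\in J\}$. (VQFP) is the vector problem of minimizing $\big(\frac{f_1(x)}{g_1(x)},\dots,\frac{f_m(x)}{g_m(x)}\big)$ over $x\in S$. A point $x^*\in S$ is a Pareto optimal solution of (VQFP) if there is no $x\in S$ with $\frac{f_i(x)}{g_i(x)}\le\frac{f_i(x^*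 )}{g_i(x^* )}$ for all $i\in I$ and strict inequality for at least one $i$. The dual problem (VQFD) is to maximize $\big(\frac{f_1(u)}{g_1(u)},\dots,\frac{f_m(u)}{g_m(u)}\big)$ over $(u,\tau,\lambda)\in Y$, where $Y$ is the set of all $(u,\tau,\lambda)\in S\times\mathbb{R}^m\times\mathbb{R}^\ell$ such that $$\sum_{i=1}^m\tau_i\Big(\nabla f_i(u)-\frac{f_i(u)}{g_i(u)}\nabla g_i(u)\Big)+\sum_{j=1}^\ell\lambda_j\nabla h_j(u)=0,\quad \sum_{j=1}^\ell\lambda_jh_j(u)\ge0,\quad \tau_i>0\ \forall i,\quad \lambda_j\ge0\ \forall j,\quad \sum_{j=1}^\ell\lambda_j=1.$$ Convexity of a differentiable function $h:\Omega\to\mathbb{R}$: $\Omega$ is convex and $h(x)-h(y)\ge\nabla h(y)^T(x-y)$ for all $x,y\in\Omega$. *)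

(* Defs.v *)
From HB Require Import structures.
From mathcomp Require Export all_boot all_order all_algebra.
From mathcomp Require Export all_classical all_reals all_analysis.

Set Implicit Arguments.
Unset Strict Implicit.
Unset Printing Implicit Defensive.

Export Order.TTheory GRing.Theory Num.Theory.
Export numFieldNormedType.Exports.

Local Open Scope classical_set_scope.
Local Open Scope ring_scope.

Definition dotv (R : realType) (n : nat) (u v : 'cV[R]_n) : R :=
  (u^T *m v) 0 0.

Definition qform (R : realType) (n : nat) (M : 'M[R]_n) (x : 'cV[R]_n) : R :=
  (x^T *m M *m x) 0 0.

(* Only the sign condition: symmetry of the matrices is a separate hypothesis. *)
Definition psd (R : realType) (n : nat) (M : 'M[R]_n) : Prop :=
  forall x : 'cV[R]_n, 0 <= qform M x.

Definition quadfun (R : realType) (n : nat) (M : 'M[R]_n) (b : 'cV[R]_n)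
    (c : R) (x : 'cV[R]_n) : R :=
  qform M x + dotv b x + c.

(* Functions defined on an open set Omega are represented by total functions   *)
(* on R^n; as Omega is open, their derivatives at points of Omega depend only  *)
(* on their values on Omega.                                                   *)
Definition gradient (R : realType) (n : nat) (f : 'cV[R]_n -> R)
    (x : 'cV[R]_n) : 'cV[R]_n :=
  \col_(k < n) 'D_(delta_mx k 0) f x.

Definition C1_on (R : realType) (n : nat) (Omega : set 'cV[R]_n)
    (f : 'cV[R]_n -> R) : Prop :=
  (forall x, Omega x -> differentiable f x) /\
  {within Omega, continuous (gradient f)}.

Definition diff_convex_on (R : realType) (n : nat) (Omega : set 'cV[R]_n)
    (f : 'cV[R]_n -> R) : Prop :=
  convex_set Omega /\
  forall x y, Omega x -> Omega y -> f x - f y >= dotv (gradient f y) (x - y).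

Definition pareto_optimal (R : realType) (m : nat) (X : Type) (S : set X)
    (phi : 'I_m -> X -> R) (xs : X) : Prop :=
  S xs /\
  ~ exists x, [/\ S x, forall i, phi i x <= phi i xs
                & exists i, phi i x < phi i xs].

Definition ratio (R : realType) (m n : nat) (f g : 'I_m -> 'cV[R]_n -> R)
    (i : 'I_m) (x : 'cV[R]_n) : R :=
  f i x / g i x.

Definition VQFP_feasible (R : realType) (ell n : nat) (Omega : set 'cV[R]_n)
    (h : 'I_ell -> 'cV[R]_n -> R) : set 'cV[R]_n :=
  [set x | Omega x /\ forall j, h j x <= 0].

Definition VQFD_feasible (R : realType) (m ell n : nat) (Omega : set 'cV[R]_n)
    (f g : 'I_m -> 'cV[R]_n -> R) (h : 'I_ell -> 'cV[R]_n -> R) :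
    set ('cV[R]_n * 'cV[R]_m * 'cV[R]_ell) :=
  [set y : 'cV[R]_n * 'cV[R]_m * 'cV[R]_ell | let: (u, tau, lam) := y in
    VQFP_feasible Omega h u /\
    \sum_(i < m) tau i 0 *: (gradient (f i) u - ratio f g i u *: gradient (g i) u)
      + \sum_(j < ell) lam j 0 *: gradient (h j) u = 0 /\
    0 <= \sum_(j < ell) lam j 0 * h j u /\
    (forall i, 0 < tau i 0) /\
    (forall j, 0 <= lam j 0) /\
    \sum_(j < ell) lam j 0 = 1].

(* Main.v *)
Require Import Defs.
From mathcomp Require Import ring lra.

(* Put r_i = f_i(u)/g_i(u). Since f_i(u) - r_i g_i(u) = 0, the exact second order
   expansion of the quadratic function f_i - r_i g_i at u shows that
   sum_i tau_i (f_i - r_i g_i)(x) is the sum of the value at x - u of the quadratic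
   form F(tau, u), which is nonnegative, and of a linear term in x - u, which by
   dual feasibility and convexity of the h_j is at least
   sum_j lambda_j (h_j(u) - h_j(x)) >= 0. A point x dominating u would make this
   sum negative, as g_i > 0 and tau_i > 0. *)

Local Open Scope classical_set_scope.
Local Open Scope ring_scope.


Section DotQform.
Set Implicit Arguments.
Unset Strict Implicit.
Variables (R : realType) (n : nat).
Implicit Types (u v x : 'cV[R]_n) (M N : 'M[R]_n).

Lemma dotvDl u v x : dotv (u + v) x = dotv u x + dotv v x.
Proof. by rewrite /dotv linearD mulmxDl mxE. Qed.

Lemma dotvZl (c : R) u x : dotv (c *: u) x = c * dotv u x.
Proof. by rewrite /dotv linearZ -scalemxAl mxE. Qed.

Lemma dotv0l x : dotv 0 x = 0.
Proof. by rewrite /dotv linear0 mul0mx mxE. Qed.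

Lemma dotvDr u v x : dotv x (u + v) = dotv x u + dotv x v.
Proof. by rewrite /dotv mulmxDr mxE. Qed.

Lemma dotvZr (c : R) u x : dotv x (c *: u) = c * dotv x u.
Proof. by rewrite /dotv -scalemxAr mxE. Qed.

Lemma dotv_suml (I : finType) (F : I -> 'cV[R]_n) x :
  dotv (\sum_i F i) x = \sum_i dotv (F i) x.
Proof. exact: (big_morph (fun u => dotv u x) (fun u v => dotvDl u v x) (dotv0l x)). Qed.

Lemma dotv_delta u (k : 'I_n) : dotv u (delta_mx k 0) = u k 0.
Proof. by rewrite /dotv -colE !mxE. Qed.

Lemma qformDl M N x : qform (M + N) x = qform M x + qform N x.
Proof. by rewrite /qform mulmxDr mulmxDl mxE. Qed.

Lemma qformZl (c : R) M x : qform (c *: M) x = c * qform M x.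
Proof. by rewrite /qform -scalemxAr -scalemxAl mxE. Qed.

Lemma qform0l x : qform 0 x = 0.
Proof. by rewrite /qform mulmx0 mul0mx mxE. Qed.

Lemma qform_suml (I : finType) (F : I -> 'M[R]_n) x :
  qform (\sum_i F i) x = \sum_i qform (F i) x.
Proof. exact: (big_morph (fun M => qform M x) (fun M N => qformDl M N x) (qform0l x)). Qed.

Lemma qformE M x : qform M x = dotv x (M *m x).
Proof. by rewrite /qform /dotv mulmxA. Qed.

Lemma dotvC u v : dotv u v = dotv v u.
Proof. by rewrite /dotv -{1}[v]trmxK -trmx_mul mxE. Qed.

Lemma dotv_mulmx_sym M u v : M^T = M -> dotv u (M *m v) = dotv v (M *m u).
Proof.
by move=> Msym; rewrite dotvC /dotv trmx_mul Msym mulmxA.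
Qed.

End DotQform.

Section Quadfun.
Set Implicit Arguments.
Unset Strict Implicit.
Variables (R : realType) (n : nat).
Variables (M : 'M[R]_n) (b : 'cV[R]_n) (c : R).
Hypothesis Msym : M^T = M.
Implicit Types (u v x : 'cV[R]_n).

(** Symmetry of [M] merges the two cross terms into one, which gives the factor 2. This exact
    expansion yields both the derivative and the Taylor formula. *)
Lemma quadfun_line (t : R) u v :
  quadfun M b c (t *: v + u) =
  quadfun M b c u + t * dotv (2 *: (M *m u) + b) v + t ^+ 2 * qform M v.
Proof.
rewrite /quadfun !qformE mulmxDr -scalemxAr !(dotvDr, dotvDl) !(dotvZl, dotvZr).
rewrite (dotv_mulmx_sym u v Msym) [dotv (M *m u) v]dotvC.
by ring.
Qed.

Lemma derive_quadfun u v :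
  'D_v (quadfun M b c) u = dotv (2 *: (M *m u) + b) v.
Proof.
set L := dotv _ v; apply: cvg_lim => //.
have cvgL : (fun t : R => L + t * qform M v) @ 0^' --> L.
  (* The limit [L] is rewritten as [L + 0 * qform M v] to match the shape of the difference quotient
     for [t != 0]. *)
  rewrite -[X in _ --> X]addr0 -[in X in _ --> X](mul0r (qform M v)).
  apply: cvgD; first exact: cvg_cst.
  by apply: cvgM; [exact: (@nbhs_dnbhs R 0) | exact: cvg_cst].
apply: cvg_trans cvgL; apply: near_eq_cvg.
near=> t.
have t0 : t != 0 by near: t; exact: nbhs_dnbhs_neq.
rewrite /= quadfun_line -/L /GRing.scale /=.
by field.
Unshelve. all: by end_near. Qed.

Lemma gradient_quadfun u : gradient (quadfun M b c) u = 2 *: (M *m u) + b.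
Proof.
by apply/colP => k; rewrite mxE derive_quadfun dotv_delta.
Qed.

(** This is [quadfun_line] with [t = 1] and direction [x - u]. *)
Lemma quadfun_taylor u x :
  quadfun M b c x = quadfun M b c u
    + dotv (gradient (quadfun M b c) u) (x - u) + qform M (x - u).
Proof.
have := quadfun_line 1 u (x - u).
by rewrite scale1r subrK gradient_quadfun mul1r expr1n mul1r.
Qed.

(** The point [w] is critical, so the expansion at [w] has no linear term; the bound on [c] makes
    the value at [w] positive. *)
Lemma quadfun_gt0 (w x : 'cV[R]_n) : psd M -> 2 *: (M *m w) + b = 0 ->
  - (qform M w + dotv b w) < c -> 0 < quadfun M b c x.
Proof.
move=> Mpsd wsol; rewrite -subr_gt0 opprK => cgt.
rewrite (quadfun_taylor w) gradient_quadfun wsol dotv0l addr0.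
by apply: ltr_wpDr (Mpsd _) _; rewrite /quadfun addrC.
Qed.

End Quadfun.

Theorem theorem4p6 (R : realType) (m ell n : nat)
    (m_gt0 : (0 < m)%N) (ell_gt0 : (0 < ell)%N) (n_gt0 : (0 < n)%N)
    (Omega : set 'cV[R]_n) (Omega_open : open Omega)
    (A B : 'I_m -> 'M[R]_n) (a b : 'I_m -> 'cV[R]_n) (abar bbar : 'I_m -> R)
    (A_sym : forall i, (A i)^T = A i) (B_sym : forall i, (B i)^T = B i)
    (B_psd : forall i, psd (B i))
    (w : 'I_m -> 'cV[R]_n)
    (w_sol : forall i, 2 *: (B i *m w i) + b i = 0)
    (bbar_gt : forall i, - (qform (B i) (w i) + dotv (b i) (w i)) < bbar i)
    (h : 'I_ell -> 'cV[R]_n -> R) (h_C1 : forall j, C1_on Omega (h j)) :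
  let f := fun i => quadfun (A i) (a i) (abar i) in
  let g := fun i => quadfun (B i) (b i) (bbar i) in
  forall (us : 'cV[R]_n) (taus : 'cV[R]_m) (lams : 'cV[R]_ell),
    VQFD_feasible Omega f g h (us, taus, lams) ->
    VQFP_feasible Omega h us ->
    psd (\sum_(i < m) taus i 0 *: (A i - ratio f g i us *: B i)) ->
    (forall j, diff_convex_on Omega (h j)) ->
    pareto_optimal (VQFP_feasible Omega h) (ratio f g) us.
Proof.
move=> f g us taus lams [_ [stat [lamh [tau_gt0 [lam_ge0 _]]]]] us_feas F_psd h_cvx.
split=> // -[x [[xO hx] ratio_le [k ratio_lt]]].
have [uO _] := us_feas.
have g_gt0 i y : 0 < g i y.
  exact: (quadfun_gt0 (B_sym i) y (B_psd i) (w_sol i) (bbar_gt i)).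
pose r i := ratio f g i us; pose d := x - us.
pose p i := taus i 0 * (f i x - r i * g i x).
(* Multiplying the ratio inequalities by [g i x > 0] makes every [p i] nonpositive, and [p k]
   negative. *)
have sum_lt0 : \sum_i p i < 0.
  rewrite (bigD1 k) //= -[ltRHS]addr0; apply: ltr_leD.
    by rewrite /p pmulr_rlt0 // subr_lt0 -ltr_pdivrMr.
  apply: sumr_le0 => i _.
  by rewrite /p pmulr_rle0 // subr_le0 -ler_pdivrMr //; exact: ratio_le.
(* The constant terms of the two expansions at [us] cancel because [f i us = r i * g i us]. *)
have pE i : p i =
    dotv (taus i 0 *: (gradient (f i) us - r i *: gradient (g i) us)) d
    + qform (taus i 0 *: (A i - r i *: B i)) d.
  have fu : f i us = r i * g i us by rewrite /r /ratio divfK // gt_eqF.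
  rewrite /p /f /g (quadfun_taylor _ _ (A_sym i) us x).
  rewrite (quadfun_taylor _ _ (B_sym i) us x) -/(f i) -/(g i) fu.
  rewrite -[- (_ *: gradient _ _)]scaleNr -[- (_ *: B i)]scaleNr /d.
  rewrite dotvZl qformZl dotvDl qformDl dotvZl qformZl.
  by ring.
have := sum_lt0; rewrite (eq_bigr _ (fun i _ => pE i)) big_split /=.
rewrite -dotv_suml -qform_suml => lt0.
have := congr1 (fun z => dotv z d) stat.
rewrite /= dotvDl dotv0l [X in _ + X = _]dotv_suml => stat_d.
(* Convexity bounds this by the weighted sum of [h j x - h j us], where the part at [x] is
   nonpositive by feasibility and the part at [us] nonnegative by [lamh]. *)
have h_le : \sum_j dotv (lams j 0 *: gradient (h j) us) d <= 0.
  apply: (@le_trans _ _ (\sum_j lams j 0 * (h j x - h j us))).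
    apply: ler_sum => j _; rewrite dotvZl ler_wpM2l //.
    by have [_] := h_cvx j; apply.
  under eq_bigr do rewrite mulrBr.
  rewrite sumrB subr_le0; apply: le_trans lamh.
  by apply: sumr_le0 => j _; rewrite mulr_ge0_le0.
(* By [stat_d] and [h_le] the linear part in [lt0] is nonnegative, and so is the quadratic part: a
   contradiction. *)
have := F_psd d; rewrite -/r; lra.
Qed.
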